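(* Let $q$ be a prime power, $m\ge2$ an integer, and let $S(m,q)$ be the $q$-ary Simplex code, with parameters $[(q^m-1)/(q-1),\,m,\,q^{m-1}]$. Then for every integer $\kappa$ with $2\le\kappa\le m$, the code $S(m,q)$ has all-symbol dimension-locality $(\kappa,q^{\kappa-1})$ and all-symbol locality $(r,\delta)$ with $$\delta=q^{\kappa-1},\qquad r=\frac{q^{\kappa}-1}{q-1}-q^{\kappa-1}+1=\frac{q^{\kappa-1}+q-2}{q-1}.$$ Moreover, with $n=(q^m-1)/(q-1)$, $d=q^{m-1}$, these $(r,\delta)$, and any integer $\kappa_B$ which is an upper bound on the dimension of linear codes over $\mathbb{F}_q$ of length $r+\delta-1$ and minimum distance at least $\delta$, $S(m,q)$ attains the following upper bound on the dimension of LRCs with equality: $$m=\min_{\lambda\in\mathbb{Z}_+}\left\{\lambda+k_{\mathrm{opt}}^{(q)}\bigl(n-(a+1)\mathcal{G}(\kappa_B,\delta)+\mathcal{G}(\kappa_B-b,\delta),\,d\bigr)\right\},$$ where, for each $\lambda$, the integers $a,b$ are determined by $\lambda=a\kappa_B+b$, $0\le b<\kappa_B$; the minimum is attained at $\lambda=0$.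
   Context: $\mathbb{Z}_+=\{0,1,2,\dots\}$, $[n]=\{1,\dots,n\}$. The Simplex code $S(m,q)$ is the linear code generated by an $m\times n$ matrix over $\mathbb{F}_q$, $n=\frac{q^m-1}{q-1}$, whose columns are non-zero and pairwise linearly independent. For $I\subseteq[n]$, $\mathcal{C}|_I=\{\mathbf{c}_I:\mathbf{c}\in\mathcal{C}\}$ is the restriction and $H(I)=\dim\mathcal{C}|_I$. A linear code $\mathcal{C}$ of length $n$ has all-symbol dimension-locality $(\kappa,\delta)$ if for every $i\in[n]$ there is $R\subseteq[n]$ with $i\in R$, $H(R)\le\kappa$, and the minimum distance of $\mathcal{C}|_R$ at least $\delta$. It has all-symbol locality $(r,\delta)$ if for every $i\in[n]$ there is $R\subseteq[n]$ with $i\in R$, $|R|\le r+\delta-1$, and the minimum distance of $\mathcal{C}|_R$ at least $\delta$. Griesmer function over $\mathbb{F}_q$: $\mathcal{G}(k,d)=\sum_{i=0}^{k-1}\lceil d/q^i\rceil$ (so $\mathcal{G}(0,d)=0$). $k_{\mathrm{opt}}^{(q)}(m',d)$ is the largest dimension of a linear code over $\mathbb{F}_q$ of length $m'$ and minimum distance at least $d$; it equals $0$ if there is no such nonzero code (in particular if $m'<d$, including $m'\le0$). *)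

(* Defs.v *)
From HB Require Import structures.
From mathcomp Require Import all_boot all_order all_algebra.

Set Implicit Arguments.
Unset Strict Implicit.
Unset Printing Implicit Defensive.

Import GRing.Theory.
Local Open Scope ring_scope.

(* A linear code of length n over F is a subspace of 'rV[F]_n; coordinates are
   indexed by 'I_n (from 0) instead of by [n] = {1, ..., n}. *)
Notation linear_code F n := {vspace 'rV[F]_n}.

(* A finite-dimensional space over a finite field has finitely many subspaces;
   this allows maxima over all linear codes of a given length. *)
Section FiniteVspace.
Import VectorInternalTheory.
Variables (F : finFieldType) (vT : vectType F).

HB.instance Definition _ := [Countable of {vspace vT} by <:].
HB.instance Definition _ := [Finite of {vspace vT} by <:].

End FiniteVspace.

Section Codes.
Variable F : finFieldType.

Definition hamming_dist n (x y : 'rV[F]_n) : nat :=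
  #|[set i : 'I_n | x 0 i != y 0 i]|.

(* The minimum distance of a nonzero code is the least distance between two
   distinct codewords (the neutral value n of the minimum is harmless, as all
   distances are at most n).  The zero code has no two distinct codewords; it
   is given the value 0, so that it never has minimum distance at least d for
   d > 0. *)
Definition min_dist n (C : linear_code F n) : nat :=
  if C == 0%VS then 0%N
  else \big[Order.min/n]_(p : 'rV[F]_n * 'rV[F]_n |
          [&& p.1 \in C, p.2 \in C & p.1 != p.2]) hamming_dist p.1 p.2.

(* The restriction C|_I, the coordinates in I being listed in increasing
   order. *)
Definition restr n (C : linear_code F n) (I : {set 'I_n}) :
    linear_code F #|I| :=
  (linfun (colsub (@enum_val _ (mem I)) : 'rV[F]_n -> 'rV[F]_#|I|) @: C)%VS.

Definition dim_restr n (C : linear_code F n) (I : {set 'I_n}) : nat :=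
  \dim (restr C I).

Definition code_gen m n (G : 'M[F]_(m, n)) : linear_code F n :=
  <<[seq row i G | i : 'I_m]>>%VS.

Definition is_simplex_code (m n : nat) (C : linear_code F n) : Prop :=
  n = ((#|F| ^ m - 1) %/ (#|F| - 1))%N /\
  exists G : 'M[F]_(m, n),
    [/\ forall j, col j G != 0,
        forall j1 j2, j1 != j2 -> free [:: col j1 G; col j2 G]
      & C = code_gen G].

Definition all_symbol_dim_locality n (C : linear_code F n)
    (kappa delta : nat) : Prop :=
  forall i : 'I_n, exists R : {set 'I_n},
    [/\ i \in R, (dim_restr C R <= kappa)%N
      & (delta <= min_dist (restr C R))%N].

Definition all_symbol_locality n (C : linear_code F n)
    (r delta : nat) : Prop :=
  forall i : 'I_n, exists R : {set 'I_n},
    [/\ i \in R, (#|R| <= r + delta - 1)%N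
      & (delta <= min_dist (restr C R))%N].

(* The length is an integer, possibly negative; a maximum over the empty
   family is 0. *)
Definition k_opt (len : int) (d : nat) : nat :=
  match len with
  | Posz n => \max_(C : linear_code F n | (d <= min_dist C)%N) \dim C
  | Negz _ => 0%N
  end.

Definition ceil_div (a b : nat) : nat := ((a + (b - 1)) %/ b)%N.

Definition griesmer (k d : nat) : nat :=
  (\sum_(i < k) ceil_div d (#|F| ^ i))%N.

(* The quantity minimised over lambda = a * kB + b, 0 <= b < kB. *)
Definition lrc_bound_term (n d kB delta lambda : nat) : nat :=
  let a := (lambda %/ kB)%N in
  let b := (lambda %% kB)%N in
  (lambda + k_opt (n%:Z - ((a + 1) * griesmer kB delta)%:Z
                   + (griesmer (kB - b) delta)%:Z) d)%N.

End Codes.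

Definition is_minimum (f : nat -> nat) (v : nat) : Prop :=
  (exists l, f l = v) /\ (forall l, v <= f l)%N.

(* Main.v *)
Require Import Defs.
From mathcomp Require Import all_boot all_order all_algebra all_character.
From mathcomp Require Import zify.

(* The columns of G represent each point of the projective space of F^m exactly
   once, so restricting the Simplex code to the points of a k-dimensional
   subspace U gives a code of dimension k and length (q^k - 1)/(q - 1), all of
   whose nonzero codewords have weight q^(k-1).  Taking U of dimension kappa
   through a given point yields the local codes, and also kB >= kappa.  At
   lambda = 0 the bound is k_opt(n, d), which equals m by the Plotkin bound.
   For lambda < m, kB >= kappa implies that the length decreases by at most
   (q^lambda - 1)/(q - 1); hence the deleted coordinates can be taken among the
   points of a subspace of dimension lambda, and the subcode of C vanishing on
   that subspace has dimension m - lambda and still weight d. *)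

Set Implicit Arguments.
Unset Strict Implicit.
Unset Printing Implicit Defensive.

Import Order.TTheory GRing.Theory.

(** * Generator matrices, weights and the Plotkin bound *)

Section LinearCodes.
Local Open Scope ring_scope.
Variable F : finFieldType.

Definition weight n (x : 'rV[F]_n) : nat := #|[set i | x 0 i != 0]|.

Lemma hamming_distE n (x y : 'rV[F]_n) : hamming_dist x y = weight (x - y).
Proof. by apply: eq_card => i; rewrite !inE !mxE subr_eq0. Qed.

Lemma weight_le n (x : 'rV[F]_n) : (weight x <= n)%N.
Proof. by rewrite -[leqRHS]card_ord max_card. Qed.

Lemma weight_eq0 n (x : 'rV[F]_n) : (weight x == 0)%N = (x == 0).
Proof.
apply/idP/eqP => [|->]; last first.
  by rewrite cards_eq0; apply/eqP/setP=> i; rewrite !inE mxE eqxx.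
rewrite cards_eq0 => /eqP/setP x0; apply/rowP=> i.
by move: (x0 i); rewrite !inE mxE => /negbFE/eqP.
Qed.

Lemma mem_code_gen k n (G : 'M[F]_(k, n)) x :
  (x \in code_gen G) = (x <= G)%MS.
Proof.
apply/idP/submxP => [|[u ->]]; last first.
  rewrite mulmx_sum_row memv_suml // => i _.
  by rewrite memvZ // memv_span //; apply/imageP; exists i.
have sub : (code_gen G <= linfun (mulmxr G) @: fullv)%VS.
  apply/span_subvP => _ /imageP[i _ ->]; rewrite rowE.
  by rewrite -[_ *m G]/(mulmxr G _) -lfunE memv_img // memvf.
by move=> /(subvP sub)/memv_imgP[u _]; rewrite lfunE; exists u.
Qed.

Lemma eqmx_code_gen k1 k2 n (G1 : 'M[F]_(k1, n)) (G2 : 'M[F]_(k2, n)) :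
  (G1 :=: G2)%MS -> code_gen G1 = code_gen G2.
Proof. by move=> eqG; apply/vspaceP=> x; rewrite !mem_code_gen eqG. Qed.

Lemma dim_code_gen k n (G : 'M[F]_(k, n)) : \dim (code_gen G) = \rank G.
Proof.
rewrite -(eqmx_code_gen (eq_row_base G)).
have free_base := row_base_free G.
suff -> : code_gen (row_base G) = (linfun (mulmxr (row_base G)) @: fullv)%VS.
  rewrite limg_dim_eq; first by rewrite dimvf dim_matrix mul1r.
  apply/eqP; rewrite -subv0 capfv; apply/subvP=> u.
  by rewrite memv_ker lfunE /= memv0 mulmx_free_eq0.
apply/vspaceP=> x; rewrite mem_code_gen; apply/submxP/memv_imgP => [[u ->]|[u _ ->]].
  by exists u; rewrite ?memvf ?lfunE.
by exists u; rewrite lfunE.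
Qed.

(** Supplies every code with a generator matrix, so that bounds proved for matrices reach all
    codes. *)
Lemma code_gen_vbasis n (C : linear_code F n) :
  code_gen (\matrix_(i < \dim C) tnth (vbasis C) i) = C.
Proof.
rewrite -[RHS](span_basis (vbasisP C)); apply: eq_span => x.
apply/imageP/tnthP => [[i _ ->]|[i ->]]; exists i; rewrite ?rowK //.
Qed.

Lemma restr_code_gen k n (G : 'M[F]_(k, n)) (I : {set 'I_n}) :
  restr (code_gen G) I = code_gen (colsub (@enum_val _ (mem I)) G).
Proof.
apply/vspaceP=> x; rewrite mem_code_gen.
apply/memv_imgP/submxP => [[y]|[u ->]].
  rewrite mem_code_gen lfunE => /submxP[u ->] ->; exists u.
  by rewrite /= mulmx_colsub.
by exists (u *m G); rewrite ?mem_code_gen ?submxMl // lfunE /= mulmx_colsub.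
Qed.

Lemma min_dist_ge k n (G : 'M[F]_(k, n)) d : G != 0 ->
    (forall u : 'rV_k, u *m G != 0 -> (d <= weight (u *m G))%N) ->
  (d <= min_dist (code_gen G))%N.
Proof.
move=> G_neq0 wtG; rewrite /min_dist -dimv_eq0 dim_code_gen mxrank_eq0.
rewrite (negPf G_neq0) -leEnat; apply: le_bigmin => [|[x y] /and3P[]] /=.
  (* The neutral value [n] of the minimum must also be at least [d]: a nonzero row has weight
     between [d] and [n]. *)
  have [i Gi0] : exists i, row i G != 0.
    apply/existsP; apply: contraNT G_neq0 => /existsPn G0.
    by apply/eqP/row_matrixP=> i; rewrite row0; apply/eqP; rewrite -[_ == _]negbK.
  by rewrite rowE in Gi0; apply: leq_trans (wtG _ Gi0) (weight_le _).
rewrite !mem_code_gen hamming_distE -subr_eq0.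
by move=> /submxP[u ->] /submxP[v ->]; rewrite -mulmxBl => /wtG.
Qed.

Lemma min_dist_le_weight n (C : linear_code F n) x :
  x \in C -> x != 0 -> (min_dist C <= weight x)%N.
Proof.
move=> Cx x0; rewrite /min_dist; case: eqP => [C0|_] //.
rewrite -[x]subr0 -hamming_distE -leEnat.
by apply: (bigmin_le_cond _ (j := (x, 0))); rewrite /= Cx mem0v.
Qed.


Lemma weight_colsub n (x : 'rV[F]_n) (I : {set 'I_n}) :
  weight (colsub (@enum_val _ (mem I)) x) = #|[set i in I | x 0 i != 0]|.
Proof.
rewrite -[LHS](card_imset _ (@enum_val_inj _ (mem I))).
apply: eq_card => i; apply/imsetP/idP => [[j]|].
  by rewrite !inE mxE => xj ->; rewrite enum_valP.
rewrite inE => /andP[Ii xi]; exists (enum_rank_in Ii i).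
  by rewrite inE mxE enum_rankK_in.
by rewrite enum_rankK_in.
Qed.

(* Plotkin's averaging argument: each coordinate vanishes on at least a
   fraction 1/q of the codewords. *)
Lemma plotkin k n (G : 'M[F]_(k, n)) d :
    (forall u : 'rV_k, u != 0 -> (d <= weight (u *m G))%N) ->
  ((#|F| ^ k - 1) * d <= n * (#|F| ^ k - #|F| ^ (k - 1)))%N.
Proof.
move=> wtG.
have card_rV : #|{: 'rV[F]_k}| = (#|F| ^ k)%N by rewrite card_mx mul1n.
apply: (@leq_trans (\sum_(u : 'rV_k | u != 0) weight (u *m G))).
  apply: (@leq_trans (\sum_(u : 'rV[F]_k | u != 0) d)); last exact: leq_sum.
  by rewrite sum_nat_const cardC1 card_rV subn1.
apply: (@leq_trans (\sum_(u : 'rV[F]_k) \sum_(i < n) ((u *m G) 0%R i != 0%R))).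
  rewrite big_mkcond /=; apply: leq_sum => u _.
  case: ifP => // _; rewrite /weight -sum1_card big_mkcond /=.
  by apply: leq_sum => i _; rewrite inE; case: eqP.
rewrite exchange_big /=.
apply: (@leq_trans (\sum_(i < n) (#|F| ^ k - #|F| ^ (k - 1)))%N); last first.
  by rewrite sum_nat_const card_ord.
apply: leq_sum => i _.
(* The codeword of [u] is nonzero at [i] exactly when [u] lies outside the kernel of column [i],
   whose dimension is at least [k - 1]. *)
have -> : (\sum_(u : 'rV[F]_k) ((u *m G) 0%R i != 0%R) =
           #|~: rowg (kermx (col i G))|)%N.
  rewrite -sum1_card [RHS]big_mkcond /=; apply: eq_bigr => u _.
  rewrite inE inE (sameP sub_kermxP eqP) colE mulmxA -colE.
  suff -> : (col i (u *m G) == 0) = ((u *m G) 0 i == 0) by case: eqP.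
  apply/eqP/eqP => [/matrixP/(_ 0 0)|ui]; first by rewrite !mxE.
  by apply/matrixP=> a b; rewrite !ord1 [RHS]mxE mxE.
rewrite cardsCs setCK card_rowg card_rV leq_sub2l // leq_exp2l ?card_finRing_gt1 //.
by rewrite mxrank_ker leq_sub2l // rank_leq_col.
Qed.

Lemma k_opt_le n m d : (0 < d)%N ->
    (forall k (G : 'M[F]_(k, n)),
       (forall u : 'rV_k, u != 0 -> (d <= weight (u *m G))%N) -> (k <= m)%N) ->
  (k_opt F n%:Z d <= m)%N.
Proof.
move=> d_gt0 le_m; apply/bigmax_leqP => C dC.
set G := \matrix_(i < \dim C) tnth (vbasis C) i.
have freeG : row_free G by rewrite /row_free -dim_code_gen code_gen_vbasis.
apply: (le_m _ G) => u u_neq0; apply: leq_trans dC _.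
apply: min_dist_le_weight; last by rewrite mulmx_free_eq0.
by have := submxMl u G; rewrite -mem_code_gen code_gen_vbasis.
Qed.

Lemma k_opt_ge k n (G : 'M[F]_(k, n)) d : (0 < d)%N ->
    (forall u : 'rV_k, u != 0 -> (d <= weight (u *m G))%N) ->
  (k <= k_opt F n%:Z d)%N.
Proof.
move=> d_gt0 wtG.
have freeG : row_free G.
  apply/inj_row_free => u uG0; apply/eqP; apply: contraTT d_gt0 => /wtG.
  by rewrite uG0 (eqP (_ : weight 0 == 0%N)) ?weight_eq0 // leqn0 lt0n negbK.
(* The zero code has [min_dist] 0 and is no candidate in the maximum, so [k = 0] is treated
   apart. *)
have [->//|k_gt0] := posnP k.
have dimG : \dim (code_gen G) = k by rewrite dim_code_gen (eqP freeG).
rewrite -[leqLHS]dimG /k_opt; apply: (@leq_bigmax_cond _ _ (fun C => \dim C)).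
apply: min_dist_ge => [|u uG_neq0].
  by rewrite -mxrank_eq0 (eqP freeG) -lt0n.
by apply: wtG; apply: contraNneq uG_neq0 => ->; rewrite mul0mx.
Qed.

End LinearCodes.

(** * Simplex codes restricted to projective subspaces *)

Section SimplexCode.
Local Open Scope ring_scope.
Variables (F : finFieldType) (m n : nat) (G : 'M[F]_(m, n)).
Hypothesis G_n : n = ((#|F| ^ m - 1) %/ (#|F| - 1))%N.
Hypothesis G_neq0 : forall j, col j G != 0.
Hypothesis G_free : forall j1 j2, j1 != j2 -> free [:: col j1 G; col j2 G].

Let q_gt1 : (1 < #|F|)%N := card_finRing_gt1 F.

Lemma dvdn_pred_exp q k : (q - 1 %| q ^ k - 1)%N.
Proof. by rewrite !subn1 predn_exp dvdn_mulr. Qed.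

(* Columns are read as points of the projective space; a subspace of it is the
   row space of a matrix. *)
Definition points k (U : 'M[F]_(k, m)) : {set 'I_n} :=
  [set j | ((col j G)^T <= U)%MS].

Let mult (p : F * 'I_n) : 'rV[F]_m := p.1 *: (col p.2 G)^T.

Let mult_inj : {in setX [set~ 0] [set: 'I_n] &, injective mult}.
Proof.
move=> [a i] [b j]; rewrite !inE !andbT /mult /= => a0 b0 eq_ab.
have /trmx_inj eq_col : (a *: col i G)^T = (b *: col j G)^T by rewrite !linearZ.
have [eq_ij|/G_free] := eqVneq i j; last first.
  rewrite free_cons span_seq1 => /andP[/vlineP[]].
  by exists (a^-1 * b); rewrite -scalerA -eq_col scalerA mulVf ?scale1r.
move: eq_col; rewrite -eq_ij => /eqP; rewrite -subr_eq0 -scalerBl scaler_eq0.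
by rewrite (negPf (G_neq0 i)) orbF subr_eq0 => /eqP->.
Qed.

(* The nonzero multiples of the columns are pairwise distinct nonzero vectors,
   and there are (q - 1) n = q ^ m - 1 of them. *)
Let mult_onto : mult @: setX [set~ 0] setT = [set~ 0].
Proof.
apply/eqP; rewrite eqEcard card_in_imset //; apply/andP; split.
  apply/subsetP=> v /imsetP[[a i]]; rewrite !inE !andbT /= => a0 ->.
  by rewrite /mult scaler_eq0 (negPf a0) trmx_eq0 G_neq0.
rewrite cardsX !cardsC1 cardsT card_ord card_mx mul1n G_n -!subn1.
by rewrite mulnC divnK ?dvdn_pred_exp.
Qed.

Lemma simplex_pointP (v : 'rV[F]_m) : v != 0 ->
  exists2 a : F, a != 0 & exists j, v = a *: (col j G)^T.
Proof.
move=> v0; have : v \in mult @: setX [set~ 0] setT by rewrite mult_onto !inE.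
by case/imsetP=> [[a j]]; rewrite !inE andbT /= => a0 ->; exists a => //; exists j.
Qed.

(** [mult] matches the nonzero vectors of the row space of [U] with the pairs of a nonzero scalar
    and a point of [U]. *)
Lemma card_points k (U : 'M[F]_(k, m)) :
  (#|points U| * (#|F| - 1) = #|F| ^ \rank U - 1)%N.
Proof.
rewrite -card_rowg (cardsD1 0 (rowg U)) inE sub0mx add1n !subn1 /=.
have -> : rowg U :\ 0 = mult @: setX [set~ 0] (points U).
  apply/setP=> v; apply/idP/imsetP=> [|[[a j]]].
    rewrite !inE => /andP[/simplex_pointP[a a0 [j ->]]] Uv.
    by exists (a, j) => //; rewrite !inE a0; rewrite eqmx_scale in Uv.
  rewrite !inE /mult /= => /andP[a0 Uj] ->.
  by rewrite scaler_eq0 (negPf a0) trmx_eq0 G_neq0 scalemx_sub.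
rewrite card_in_imset => [|x y]; first by rewrite cardsX cardsC1 mulnC.
rewrite !inE => /andP[x0 _] /andP[y0 _].
by apply: mult_inj; rewrite !inE ?x0 ?y0.
Qed.

Lemma points1 : points 1%:M = setT.
Proof. by apply/setP=> j; rewrite !inE submx1. Qed.

(** The columns at [points U] span the row space of [U]: they lie in it, and each nonzero row of [U]
    is a multiple of one of them. *)
Lemma rank_simplex_restr k (U : 'M[F]_(k, m)) :
  \rank (colsub (@enum_val _ (mem (points U))) G) = \rank U.
Proof.
rewrite -mxrank_tr; apply/eqP; rewrite eqn_leq; apply/andP; split; apply: mxrankS.
  apply/row_subP=> i; have := enum_valP i; rewrite inE.
  by congr (_ <= _)%MS; apply/rowP=> j; rewrite !mxE.
apply/row_subP=> i; have [->|/simplex_pointP[a a0 [j Ui]]] := eqVneq (row i U) 0.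
  exact: sub0mx.
have Uj : j \in points U by rewrite inE -(eqmx_scale _ a0) -Ui row_sub.
rewrite Ui scalemx_sub //.
suff -> : (col j G)^T = row (enum_rank_in Uj j)
   (colsub (@enum_val _ (mem (points U))) G)^T by exact: row_sub.
by apply/rowP=> l; rewrite !mxE enum_rankK_in.
Qed.

Lemma row_free_simplex : row_free G.
Proof.
rewrite /row_free -mxrank_tr; suff /eqmxP: (G^T == 1%:M)%MS.
  by move=> ->; rewrite mxrank1.
rewrite submx1; apply/row_subP=> i.
have [->|/simplex_pointP[a _ [j ->]]] := eqVneq (row i (1%:M : 'M[F]_m)) 0.
  exact: sub0mx.
by rewrite tr_col scalemx_sub ?row_sub.
Qed.

(** The codeword of [u] vanishes at [j] exactly when column [j] is orthogonal to [u]. *)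
Lemma support_points k (U : 'M[F]_(k, m)) (u : 'rV_m) :
  [set j in points U | (u *m G) 0 j != 0] =
  points U :\: points (U :&: kermx u^T)%MS.
Proof.
apply/setP=> j; rewrite !inE sub_capmx; case: (_ <= U)%MS => //=.
rewrite andbT (sameP sub_kermxP eqP) -trmx_mul trmx_eq0 colE mulmxA -colE.
congr (~~ _); apply/eqP/eqP => [uj|/matrixP/(_ 0 0)]; last by rewrite !mxE.
by apply/matrixP=> a b; rewrite !ord1 [RHS]mxE mxE.
Qed.

(** The support consists of the points of [U] off a hyperplane of [U]; with [s] the rank of [U],
    their number is [(q^s - q^(s-1))/(q-1) = q^(s-1)]. *)
Lemma card_support_points k (U : 'M[F]_(k, m)) (u : 'rV_m) :
    [set j in points U | (u *m G) 0 j != 0] != set0 ->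
  #|[set j in points U | (u *m G) 0 j != 0]| = (#|F| ^ (\rank U - 1))%N.
Proof.
rewrite support_points => supp_neq0.
have sub_UK : points (U :&: kermx u^T)%MS \subset points U.
  by apply/subsetP=> j; rewrite !inE sub_capmx => /andP[].
(* A nonempty support means that [u] does not annihilate [U], so its kernel has codimension one
   there. *)
have Uu : \rank (U *m u^T) = 1%N.
  apply/eqP; rewrite eqn_leq rank_leq_col lt0n mxrank_eq0.
  apply: contraNneq supp_neq0 => Uu0; rewrite setD_eq0.
  apply/subsetP=> j; rewrite !inE => Uj; rewrite sub_capmx Uj.
  by apply: submx_trans Uj _; apply/sub_kermxP.
have rankU : \rank U = (\rank (U :&: kermx u^T)%MS).+1.
  by rewrite -(mxrank_mul_ker U u^T) Uu.
apply/eqP; rewrite -(eqn_pmul2r (m := #|F| - 1)) ?subn_gt0 //.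
rewrite cardsD (setIidPr sub_UK) mulnBl !card_points rankU subSS subn0 expnS.
have : (0 < #|F| ^ \rank (U :&: kermx u^T)%MS)%N by rewrite expn_gt0 ltnW.
move: (#|F| ^ _)%N => x; move: (#|F|) q_gt1 => q; nia.
Qed.

Lemma weight_simplex (u : 'rV_m) : u != 0 ->
  weight (u *m G) = (#|F| ^ (m - 1))%N.
Proof.
have supp : [set j in points 1%:M | (u *m G) 0 j != 0] = [set j | (u *m G) 0 j != 0].
  by apply/setP=> j; rewrite points1 !inE.
move=> u0; have := @card_support_points _ 1%:M u; rewrite mxrank1 supp; apply.
by rewrite -cards_eq0 [_ == _]weight_eq0 mulmx_free_eq0 ?row_free_simplex.
Qed.

Lemma min_dist_simplex_restr k (U : 'M[F]_(k, m)) : (0 < \rank U)%N ->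
  (#|F| ^ (\rank U - 1) <= min_dist (restr (code_gen G) (points U)))%N.
Proof.
move=> U_gt0; rewrite restr_code_gen; apply: min_dist_ge => [|u].
  by rewrite -mxrank_eq0 rank_simplex_restr -lt0n.
rewrite mulmx_colsub -weight_eq0 weight_colsub => supp.
by rewrite card_support_points // -cards_eq0.
Qed.

Lemma dim_simplex_restr k (U : 'M[F]_(k, m)) :
  dim_restr (code_gen G) (points U) = \rank U.
Proof. by rewrite /dim_restr restr_code_gen dim_code_gen rank_simplex_restr. Qed.

Lemma min_dist_simplex : (0 < m)%N ->
  min_dist (code_gen G) = (#|F| ^ (m - 1))%N.
Proof.
move=> m_gt0; apply/eqP; rewrite eqn_leq; apply/andP; split.
  pose u : 'rV[F]_m := delta_mx 0 (Ordinal m_gt0).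
  have u0 : u != 0.
    apply: contra_neq (oner_neq0 F) => /rowP/(_ (Ordinal m_gt0)).
    by rewrite !mxE !eqxx.
  rewrite -(weight_simplex u0) min_dist_le_weight ?mem_code_gen ?submxMl //.
  by rewrite mulmx_free_eq0 ?row_free_simplex.
apply: min_dist_ge => [|u uG0].
  by rewrite -mxrank_eq0 (eqP row_free_simplex) -lt0n.
by rewrite weight_simplex //; apply: contraNneq uG0 => ->; rewrite mul0mx.
Qed.

Lemma points_extend j k : (0 < k <= m)%N ->
  exists2 U : 'M[F]_m, \rank U = k & j \in points U.
Proof.
move=> /andP[k_gt0 le_km]; pose v := (col j G)^T.
have rank_v : \rank v = 1%N by rewrite rank_rV trmx_eq0 G_neq0.
(* The first [k] rows of the invertible matrix [row_ebase v] are independent, and [v] is a multiple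
   of the first one. *)
exists (pid_mx k *m row_ebase v).
  by rewrite mxrankMfree ?rank_pid_mx // row_free_unit row_ebase_unit.
rewrite inE -/v -[X in (X <= _)%MS](mulmx_ebase v) rank_v.
have -> : pid_mx 1 = (pid_mx 1 : 'M[F]_(1, m)) *m (pid_mx k : 'M_m).
  by rewrite mul_pid_mx (minn_idPl k_gt0) (minn_idPr _) // (leq_trans k_gt0).
by rewrite -!mulmxA mulmxA submxMl.
Qed.

(* Shortening at a subspace of dimension [\rank U], then puncturing some of the
   coordinates that became zero. *)
Lemma k_opt_shorten k (U : 'M[F]_(k, m)) (J : {set 'I_n}) :
    J \subset points U ->
  (m - \rank U <= k_opt F #|~: J|%:Z (#|F| ^ (m - 1)))%N.
Proof.
move=> sJU; rewrite -(mxrank_tr U) -mxrank_ker.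
(* The rows of [K] form a basis of the messages orthogonal to [U]. Their codewords vanish on
   [points U], so deleting [J] costs no weight. *)
pose K := row_base (kermx U^T).
apply: (@k_opt_ge _ _ _ (K *m colsub (@enum_val _ (mem (~: J))) G)).
  by rewrite expn_gt0 ltnW.
move=> u u0; rewrite mulmxA mulmx_colsub weight_colsub.
have uK0 : u *m K != 0 by rewrite mulmx_free_eq0 ?row_base_free.
have uKU : u *m K *m U^T = 0.
  by apply/sub_kermxP; rewrite (submx_trans (submxMl _ _)) ?eq_row_base.
rewrite -(weight_simplex uK0); apply/subset_leq_card/subsetP=> j.
rewrite !inE => uKj; rewrite uKj andbT.
apply: contra uKj => /(subsetP sJU); rewrite inE => /submxP[x /(congr1 trmx)].
rewrite trmxK trmx_mul => Gj.
have /matrixP/(_ 0 0) : col j (u *m K *m G) = 0.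
  by rewrite colE -mulmxA -colE Gj mulmxA uKU mul0mx.
by rewrite !mxE => ->.
Qed.

End SimplexCode.

(** * Estimates for the Griesmer function *)

Section GriesmerBound.
Variable F : finFieldType.
Let q := #|F|.
Let q_gt1 : 1 < q := card_finRing_gt1 F.

Local Notation geom k := (\sum_(i < k) q ^ i).

Let geom_superadditive j k : geom j + geom k <= geom (j + k).
Proof.
rewrite big_split_ord leq_add2l leq_sum // => i _.
by rewrite leq_exp2l //= leq_addl.
Qed.

(** Counted from the top, starting at 0, the [t]-th dropped term is the ceiling of
    [q^(kappa-1) / q^(k-1-t)], which is at most [q^t] because [kappa <= k]. *)
Let griesmer_le_drop kappa k b : 0 < kappa <= k -> b <= k ->
  griesmer F k (q ^ (kappa - 1)) <= griesmer F (k - b) (q ^ (kappa - 1)) + geom b.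
Proof.
move=> /andP[kappa_gt0 le_kappa]; elim: b => [|b IHb] lt_bk.
  by rewrite subn0 leq_addr.
apply: leq_trans (IHb (ltnW lt_bk)) _.
rewrite -(subnSK lt_bk) /griesmer !big_ord_recr /= -addnA leq_add2l.
rewrite addnC leq_add2l /ceil_div -ltnS -/q ltn_divLR ?expn_gt0 ?(ltnW q_gt1) //.
have le_q : q ^ (kappa - 1) <= q ^ b * q ^ (k - b.+1).
  by rewrite -expnD leq_exp2l //; lia.
have : 0 < q ^ (k - b.+1) by rewrite expn_gt0 ltnW.
by lia.
Qed.

Lemma leq_griesmer j k d : j <= k -> griesmer F j d <= griesmer F k d.
Proof. by move=> /subnKC <-; rewrite /griesmer big_split_ord leq_addr. Qed.

(* The left-hand side is a sum of [l] terms, the [i]-th of which is at most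
   [q ^ i]. *)
Lemma griesmer_increment_le kappa k l : 0 < kappa <= k ->
  ((l %/ k + 1) * griesmer F k (q ^ (kappa - 1))
    - griesmer F (k - l %% k) (q ^ (kappa - 1))) * (q - 1) <= q ^ l - 1.
Proof.
move=> lek; have k_gt0 : 0 < k by lia.
have geomE : (q - 1) * geom l = q ^ l - 1 by rewrite !subn1 predn_exp.
rewrite mulnC -geomE leq_mul2l; apply/orP; right.
have -> : geom l = geom (l %/ k * k + l %% k) by rewrite -divn_eq.
rewrite leq_subLR mulnDl mul1n.
have le_mod := griesmer_le_drop lek (ltnW (ltn_pmod l k_gt0)).
(* Dropping all [k] terms bounds a full block by [geom k]. *)
have := griesmer_le_drop lek (leqnn k).
rewrite subnn {2}/griesmer big_ord0 add0n => le_all.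
(* The [l %/ k] full blocks and the remainder are merged by superadditivity of [geom]. *)
suff : l %/ k * griesmer F k (q ^ (kappa - 1)) + geom (l %% k)
       <= geom (l %/ k * k + l %% k) by lia.
elim: (l %/ k) => [|a IHa]; first by [].
rewrite !mulSn -!addnA (leq_trans _ (geom_superadditive _ _)) //.
exact: leq_add.
Qed.
End GriesmerBound.

(** * Arithmetic of the parameters *)

Lemma simplex_locality q kappa r : 1 < q -> 0 < kappa ->
    r = (q ^ kappa - 1) %/ (q - 1) - q ^ (kappa - 1) + 1 ->
  [/\ q - 1 %| q ^ (kappa - 1) + q - 2,
      r = (q ^ (kappa - 1) + q - 2) %/ (q - 1)
    & (r + q ^ (kappa - 1) - 1) * (q - 1) = q ^ kappa - 1].
Proof.
case: kappa => // k q_gt1 _ ->; rewrite subSS subn0 expnSr.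
(* With [N = (q^k - 1)/(q - 1)], the local length is [N + q^k] and [r = N + 1]. *)
have /dvdnP[N geomN] := dvdn_pred_exp q k.
have exp_gt0 : 0 < q ^ k by rewrite expn_gt0 ltnW.
have exp_le : q ^ k <= q ^ k * q by rewrite leq_pmulr // ltnW.
have lenE : q ^ k * q - 1 = (N + q ^ k) * (q - 1).
  by rewrite mulnDl -geomN mulnBr muln1; lia.
have numE : q ^ k + q - 2 = N.+1 * (q - 1) by rewrite mulSn -geomN; lia.
rewrite lenE numE !mulnK ?subn_gt0 // addnK addn1 dvdn_mull //; split => //.
by rewrite addSn subn1.
Qed.

(* The Plotkin bound forces dimension at most [m] at the length and distance of
   the Simplex code. *)
Lemma plotkin_dim_le q n k m : 1 < q -> 0 < m -> n * (q - 1) = q ^ m - 1 ->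
  (q ^ k - 1) * q ^ (m - 1) <= n * (q ^ k - q ^ (k - 1)) -> k <= m.
Proof.
case: k m => [//|k] [//|m] q_gt1 _; rewrite !subSS !subn0 !ltnS !expnS => n_q.
have -> : q * q ^ k - q ^ k = (q - 1) * q ^ k by rewrite mulnBl mul1n.
rewrite mulnA n_q -(leq_exp2l k m q_gt1).
rewrite !mulnBl !mul1n mulnAC.
(* This keeps the truncated subtraction exact: the common product then cancels and [q^k <= q^m]
   remains. *)
have : q ^ k <= q * q ^ m * q ^ k by rewrite leq_pmull // muln_gt0 expn_gt0 ltnW.
lia.
Qed.

(** Identifies the number of coordinates left after deletion with the integer length in
    [lrc_bound_term]. *)
Lemma PoszBD n a b x : b <= a -> a - b + x = n ->
  Posz x = (n%:Z - a%:Z + b%:Z)%R.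
Proof. by lia. Qed.

(** * Locality of the Simplex code and equality in the bound *)

Theorem mainTheorem9 (F : finFieldType) (q m n d : nat)
    (hq : #|F| = q) (hm : (2 <= m)%N)
    (hn : n = ((q ^ m - 1) %/ (q - 1))%N)
    (hd : d = (q ^ (m - 1))%N)
    (C : linear_code F n) (hC : is_simplex_code m C) :
  (\dim C = m /\ min_dist C = d) /\
  forall (kappa delta r : nat)
    (hkappa : (2 <= kappa <= m)%N)
    (hdelta : delta = (q ^ (kappa - 1))%N)
    (hr : r = ((q ^ kappa - 1) %/ (q - 1) - q ^ (kappa - 1) + 1)%N),
  [/\ (q - 1 %| q ^ (kappa - 1) + q - 2)%N /\
      r = ((q ^ (kappa - 1) + q - 2) %/ (q - 1))%N,
      all_symbol_dim_locality C kappa delta,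
      all_symbol_locality C r delta
    & forall kB : nat,
        (forall D : linear_code F (r + delta - 1),
           (delta <= min_dist D)%N -> (\dim D <= kB)%N) ->
        is_minimum (lrc_bound_term F n d kB delta) m /\
        lrc_bound_term F n d kB delta 0 = m].
Proof.
have q_gt1 : 1 < q by rewrite -hq card_finRing_gt1.
case: hC => _ [G [G_neq0 G_free ->]].
rewrite -hq in hn; have freeG := row_free_simplex hn G_neq0 G_free.
split.
  by rewrite dim_code_gen (eqP freeG) (min_dist_simplex hn) ?hq ?(ltnW hm).
move=> kappa delta r /andP[kappa_gt1 le_kappa] hdelta hr.
have card_pts (k : nat) (U : 'M[F]_(k, m)) : #|points G U| * (q - 1) = q ^ \rank U - 1.
  by rewrite -hq; apply: card_points.
have q_dvd k : q - 1 %| q ^ k - 1 by rewrite -hq dvdn_pred_exp.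
have exp_gt0 k : 0 < q ^ k by rewrite expn_gt0 ltnW.
have [] := simplex_locality q_gt1 (ltnW kappa_gt1) hr.
rewrite -hdelta => r_dvd rE len_q.
have lenE k (U : 'M[F]_(k, m)) :
    \rank U = kappa -> #|points G U| = r + delta - 1.
  move=> rkU; apply/eqP; rewrite -(eqn_pmul2r (m := q - 1)) ?subn_gt0 //.
  by rewrite len_q card_pts rkU.
have kappa_gt0 : 0 < kappa by exact: ltnW.
have local i : exists R : {set 'I_n}, [/\ i \in R, dim_restr (code_gen G) R <= kappa,
    #|R| <= r + delta - 1 & delta <= min_dist (restr (code_gen G) R)].
  have [|U rkU Ui] := @points_extend _ _ _ _ G_neq0 i kappa; first by rewrite kappa_gt0.
  exists (points G U); split; rewrite ?(dim_simplex_restr hn) ?(lenE _ U) ?rkU //.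
  by rewrite hdelta -hq -rkU (min_dist_simplex_restr hn) ?rkU.
split.
- by [].
- by move=> i; have [R []] := local i; exists R.
- by move=> i; have [R []] := local i; exists R.
move=> kB kB_ge.
have le_kB : kappa <= kB.
  (* A local code has length [r + delta - 1], distance at least [delta] and dimension [kappa], so
     the hypothesis on [kB] applies to it. *)
  pose U : 'M[F]_m := pid_mx kappa.
  have rkU : \rank U = kappa by rewrite rank_pid_mx.
  rewrite -(lenE _ U) // in kB_ge.
  have := kB_ge (restr (code_gen G) (points G U)).
  rewrite -/(dim_restr _ _) (dim_simplex_restr hn) // rkU; apply.
  by rewrite hdelta -hq -rkU (min_dist_simplex_restr hn) ?rkU.
have bound0 : lrc_bound_term F n d kB delta 0 = m.
  (* At 0 both [a] and [b] vanish and the two Griesmer terms cancel, leaving length [n]. *)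
  rewrite /lrc_bound_term div0n mod0n subn0 mul1n GRing.subrK add0n.
  apply/eqP; rewrite eqn_leq; apply/andP; split.
    apply: k_opt_le => [|k H wtH]; first by rewrite hd.
    have := plotkin wtH; rewrite hd hq.
    have n_q : n * (q - 1) = q ^ m - 1 by rewrite hn hq divnK.
    exact: plotkin_dim_le (ltnW hm) n_q.
  apply: (@k_opt_ge _ _ _ G) => [|u u0]; first by rewrite hd.
  by rewrite (weight_simplex hn) // hq hd.
split=> //; split; first by exists 0.
move=> l; rewrite /lrc_bound_term.
have [le_ml|lt_lm] := leqP m l; first exact: leq_trans le_ml (leq_addr _ _).
pose U : 'M[F]_m := pid_mx l.
have rkU : \rank U = l by rewrite rank_pid_mx ?(ltnW lt_lm).
have := @griesmer_increment_le F kappa kB l; rewrite kappa_gt0 le_kB => /(_ isT).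
rewrite hq -hdelta -rkU -card_pts leq_pmul2r ?subn_gt0 // rkU.
set a := _ * griesmer F _ _; set b := griesmer F _ _ => le_ab.
have le_ba : b <= a.
  by rewrite /a mulnDl mul1n (leq_trans _ (leq_addl _ _)) // leq_griesmer ?leq_subr.
(* Deleting exactly [a - b] points of [U] leaves a code of the length occurring in the bound. *)
have [J sJU cardJ] : exists2 J : {set 'I_n}, J \subset points G U & #|J| = a - b.
  have [s [uniq_s size_s sub_s]] := card_geqP le_ab.
  exists [set i in s]; first by apply/subsetP=> i; rewrite inE => /sub_s.
  by rewrite cardsE (card_uniqP uniq_s).
have := k_opt_shorten hn G_neq0 G_free sJU; rewrite rkU leq_subLR hq -hd.
have cardJC : a - b + #|~: J| = n by rewrite -cardJ cardsC card_ord.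
by rewrite (PoszBD le_ba cardJC).
Qed.
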